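(* Let $\{\theta_n\}_{n=0}^\infty\subset[0,2\pi)$ be distinct points, let $\gamma_n>0$ ($n\ge 0$) satisfy $\sum_{n=0}^\infty\gamma_n<\infty$, and let $$S(z)=\exp\left(\sum_{n=0}^\infty\gamma_n\frac{z+e^{i\theta_n}}{z-e^{i\theta_n}}\right),\quad z\in\mathbb{D},$$ be the atomic singular inner function associated with $\{e^{i\theta_n}\}_{n=0}^\infty$ and $\{\gamma_n\}_{n=0}^\infty$. Assume that the following conditions are valid: (i) $\theta_0=0$, the sequence $\{\theta_n\}_{n=1}^\infty\subset(0,1)$ is strictly decreasing, and $\lim_{n\rightarrow\infty}\theta_n=0$. (ii) There exists a constant $C=C(S)>0$ such that $|\theta_{n-1}-\theta_{n+1}|\le C\gamma_n^2$ for all sufficiently large $n\in\mathbb{N}$. Then $S$ is a one-component inner function.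
   Context: $\mathbb{D}$ is the open unit disc of $\mathbb{C}$ and $\mathbb{T}$ its boundary. An inner function is a bounded analytic function in $\mathbb{D}$ having unimodular radial limits almost everywhere on $\mathbb{T}$. An inner function $\Theta$ is called a one-component inner function if the level set $\Omega_\Theta(\varepsilon)=\{z\in\mathbb{D}:|\Theta(z)|<\varepsilon\}$ is connected for some $\varepsilon\in(0,1)$. *)

(* Defs.v *)
From HB Require Import structures.
From mathcomp Require Import all_boot all_order all_algebra.
From mathcomp Require Import complex.
From mathcomp Require Import all_classical all_reals all_analysis.
Set Implicit Arguments.
Unset Strict Implicit.
Unset Printing Implicit Defensive.
Import Order.TTheory GRing.Theory Num.Theory.
Import numFieldNormedType.Exports.
Local Open Scope classical_set_scope.
Local Open Scope complex_scope.
Local Open Scope ring_scope.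

(* [R[i]^o] is the complex plane, a normed module over the field [R[i]]: its
   norm [`|z|] lives in [R[i]], so a real bound [c] on it reads [`|z| <= c%:C],
   and [derivable f z 1] over [R[i]^o] is complex differentiability at [z]. *)

Definition cexp (R : realType) (z : R[i]^o) : R[i]^o :=
  (expR (complex.Re z))%:C *
  (cos (complex.Im z) +i* sin (complex.Im z)).

Definition cis (R : realType) (t : R) : R[i]^o := cexp (0 +i* t).

Definition unit_disc (R : realType) : set R[i]^o := [set z | `|z| < 1].

Definition bounded_analytic (R : realType) (f : R[i]^o -> R[i]^o) : Prop :=
  (forall z, unit_disc z -> derivable f z 1) /\
  (exists M : R, forall z, unit_disc z -> `|f z| <= M%:C).

(* Almost every point of the unit circle is expressed as [cis t] for Lebesgue
   almost every [t] in [[0, 2 pi)]. *)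
Definition inner_function (R : realType) (f : R[i]^o -> R[i]^o) : Prop :=
  bounded_analytic f /\
  {ae @lebesgue_measure R, forall t : R, t \in `[0, 2 * pi[ ->
    exists l : R[i]^o, `|l| = 1 /\
      f (r%:C * cis t) @[r --> (1 : R)^'-] --> l}.

Definition level_set (R : realType) (f : R[i]^o -> R[i]^o) (e : R) :
  set R[i]^o := [set z | unit_disc z /\ `|f z| < e%:C].

Definition one_component_inner (R : realType) (f : R[i]^o -> R[i]^o) : Prop :=
  inner_function f /\
  exists e : R, 0 < e < 1 /\ connected (level_set f e).

(* Only the values at [z] in the unit disc matter; there the series converges
   as soon as [gamma] is nonnegative and summable. *)
Definition atomic_singular (R : realType) (theta gamma : nat -> R)
    (z : R[i]^o) : R[i]^o :=
  cexp (lim (series (fun n =>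
    (gamma n)%:C * ((z + cis (theta n)) / (z - cis (theta n))) : R[i]^o)
    @ \oo)).

(* Main.v *)
Require Import Defs.
From HB Require Import structures.
From mathcomp Require Import all_boot all_order all_algebra.
From mathcomp Require Import complex.
From mathcomp Require Import all_classical all_reals all_analysis.
From mathcomp Require Import ring lra.
Set Implicit Arguments.
Unset Strict Implicit.
Unset Printing Implicit Defensive.
Import Order.TTheory GRing.Theory Num.Theory.
Import numFieldNormedType.Exports.
Import ComplexField.Normc.
Local Open Scope classical_set_scope.
Local Open Scope ring_scope.

(** Write [e_n = cis (theta n)]. On the disc [|S| = exp (- u)], where
    [u z = \sum_n gamma_n * (1 - |z|^2) / |z - e_n|^2] is the Poisson integral
    of the atomic measure, so the level sets of [S] are the superlevel sets
    [{u > L}].  The claim behind the theorem is that for small [L > 0] the set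
    [{u > L}] is star-shaped about the origin, hence connected.

    Fix [z] in [{u > L}] and a point [w = t z] of the segment from [0] to [z].
    For each atom [e], an elementary computation ([radial_alternative]) shows
    that either the Poisson kernel of [e] is at least as large at [w] as at [z],
    or [w] is so close to [e] that [|w - e| <= q] with [q = 1 - |w|^2].  If the
    first case holds for every atom, then [u w >= u z > L].  Otherwise [w] is
    within [q] of some [e_m], and [u w] is bounded below by a constant that does
    not depend on [w] ([potential_ge_near_atom]):
    if [theta_m <= q], the atom at [1] is within [2 q] of [w] and alone
    contributes at least [gamma_0 / (4 q)]; if [theta_m > q], all the atoms
    with angle in [[theta_m - q, theta_m]] are within [2 q] of [w], each of them
    contributes at least [gamma_k / (4 q)], and the gap condition makes their
    total mass comparable to [q].  For this last step the gap condition is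
    weakened to [theta_k - theta_(k+1) = O(gamma_k)], which follows from the
    quadratic one because [gamma] is bounded ([gap_linear]), and the sum of the
    gaps telescopes.  It is enough to take [L] below both constants.

    That [S] is inner follows from a uniform estimate of the Herglotz kernels
    [(z + e) / (z - e)] away from the atoms.  A quadratic Taylor estimate can be
    summed over the atoms and gives complex differentiability in the disc
    ([derivable_herglotz_sum]); [|S| <= 1] since [u >= 0].  The atoms form a
    countable compact set, so almost every point of the circle has a positive
    distance to all of them; there the Herglotz sum is Lipschitz along the
    radius, up to the boundary, where its real part vanishes
    ([radial_limit_atomic_singular]). *)

Local Notation "x %:C" := (real_complex _ x) : ring_scope.
Local Notation re := complex.Re.
Local Notation im := complex.Im.

(** * The modulus, and limits of complex-valued functions *)

Lemma normc_normr (R : realType) (z : R[i]^o) : `|z| = (normc z)%:C.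
Proof. by []. Qed.

Lemma normc_ge0 (R : realType) (z : R[i]) : 0 <= normc z.
Proof. by case: z => a b /=; exact: sqrtr_ge0. Qed.

Lemma normc_gt0 (R : realType) (z : R[i]) : (0 < normc z) = (z != 0).
Proof. by rewrite -ltcR; exact: (@normr_gt0 _ R[i]). Qed.

Lemma normcD (R : realType) (z w : R[i]) :
  normc (z + w) <= normc z + normc w.
Proof. exact: le_normcD. Qed.

Lemma normcB (R : realType) (z w : R[i]) : normc (z - w) = normc (w - z).
Proof. by rewrite -opprB; exact: (@normcN R). Qed.

Lemma normcBD (R : realType) (a z w : R[i]) :
  normc (z - w) <= normc (z - a) + normc (a - w).
Proof. by rewrite (le_trans _ (normcD _ _)) // addrA subrK. Qed.

Lemma normc_sqr (R : realType) (z : R[i]) :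
  normc z ^+ 2 = re z ^+ 2 + im z ^+ 2.
Proof. by case: z => a b /=; rewrite sqr_sqrtr // addr_ge0 ?sqr_ge0. Qed.

Lemma normc_real (R : realType) (x : R) : normc x%:C = `|x|.
Proof. by rewrite /= expr0n addr0 sqrtr_sqr. Qed.

Lemma normc_ge_re (R : realType) (z : R[i]) : `|re z| <= normc z.
Proof.
rewrite -[leRHS](ger0_norm (normc_ge0 z)) -ler_sqr ?nnegrE //.
by rewrite !real_normK ?num_real // normc_sqr lerDl sqr_ge0.
Qed.

Lemma normc_ge_im (R : realType) (z : R[i]) : `|im z| <= normc z.
Proof.
rewrite -[leRHS](ger0_norm (normc_ge0 z)) -ler_sqr ?nnegrE //.
by rewrite !real_normK ?num_real // normc_sqr lerDr sqr_ge0.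
Qed.

Lemma normc_le_reim (R : realType) (z : R[i]) :
  normc z <= `|re z| + `|im z|.
Proof.
rewrite -ler_sqr ?nnegrE ?normc_ge0 ?addr_ge0 // normc_sqr sqrrD.
rewrite !real_normK ?num_real // addrAC lerDl.
by rewrite mulrn_wge0 // mulr_ge0.
Qed.

Lemma normcZ (R : realType) (t : R) (z : R[i]) :
  normc (t%:C * z) = `|t| * normc z.
Proof. by rewrite normcM normc_real. Qed.

Lemma normcX (R : realType) (z : R[i]) n : normc (z ^+ n) = normc z ^+ n.
Proof. by elim: n => [|n IH]; rewrite ?expr0 ?normc1 // !exprS normcM IH. Qed.

Lemma normc2 (R : realType) : normc (2 : R[i]) = 2.
Proof. by rewrite -(rmorph_nat (real_complex R)) normc_real ger0_norm. Qed.

(** The norm of [R[i]^o] and the radii of its balls are complex numbers;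
    this criterion replaces them by real ones. *)
Lemma cvg_normcP (R : realType) (T : Type) (F : set_system T) {FF : Filter F}
    (f : T -> R[i]^o) (l : R[i]^o) :
  f @ F --> l <->
  forall e : R, 0 < e -> \forall x \near F, normc (l - f x) < e.
Proof.
split=> [/cvgrPdist_lt fl e e0|fl].
  have /fl : 0 < e%:C :> R[i] by rewrite ltcR.
  by apply: filterS => x; rewrite normc_normr ltcR.
apply/cvgrPdist_lt => -[e e'] /[dup] e0; rewrite ltcE /= => /andP[/eqP e'0 re0].
by apply: filterS (fl _ re0) => x; rewrite normc_normr e'0 ltcR.
Qed.

Lemma cvg_normc_le (R : realType) (T : Type) (F : set_system T)
    {FF : Filter F} (f : T -> R[i]^o) (l : R[i]^o) (r : T -> R) :
  (\forall x \near F, normc (l - f x) <= r x) -> r @ F --> 0 -> f @ F --> l.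
Proof.
move=> fr /cvgrPdist_lt r0; apply/cvg_normcP => e /r0.
apply: filterS2 fr => x fr; rewrite sub0r normrN => /ltr_normlW.
exact: le_lt_trans.
Qed.

Lemma cvg_re (R : realType) (T : Type) (F : set_system T) {FF : Filter F}
    (f : T -> R[i]^o) (l : R[i]^o) :
  f @ F --> l -> (fun x => re (f x)) @ F --> re l.
Proof.
move=> /cvg_normcP fl; apply/cvgrPdist_lt => e /fl; apply: filterS => x.
by apply: le_lt_trans; rewrite -raddfB; exact: normc_ge_re.
Qed.

Lemma cvg_complex (R : realType) (T : Type) (F : set_system T) {FF : Filter F}
    (f : T -> R[i]^o) (a b : R) :
  (fun x => re (f x)) @ F --> a -> (fun x => im (f x)) @ F --> b ->
  f @ F --> ((a +i* b)%C : R[i]^o).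
Proof.
move=> /cvgrPdist_lt fa /cvgrPdist_lt fb; apply/cvg_normcP => e e0.
have e2 : 0 < e / 2 by rewrite divr_gt0.
apply: filterS2 (fa _ e2) (fb _ e2) => x ax bx.
apply: le_lt_trans (normc_le_reim _) _.
by rewrite !raddfB /= (splitr e) ltrD.
Qed.

Lemma re_series (R : realType) (f : nat -> R[i]^o) :
  (fun n => re (series f n)) = series (fun n => re (f n)).
Proof. by apply/funext => n; rewrite /series /= raddf_sum. Qed.

Lemma im_series (R : realType) (f : nat -> R[i]^o) :
  (fun n => im (series f n)) = series (fun n => im (f n)).
Proof. by apply/funext => n; rewrite /series /= raddf_sum. Qed.

Lemma real_series_dominated (R : realType) (f g : nat -> R) :
  (forall n, `|f n| <= g n) -> cvgn (series g) -> cvgn (series f).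
Proof.
move=> fg cg; apply: normed_cvg; apply: series_le_cvg cg => n //=.
exact: le_trans (normr_ge0 _) (fg n).
Qed.

(** Absolute convergence is checked on real and imaginary parts, where the
    completeness of [R] applies. *)
Lemma series_dominated (R : realType) (f : nat -> R[i]^o) (g : nat -> R) :
  (forall n, normc (f n) <= g n) -> cvgn (series g) -> cvgn (series f).
Proof.
move=> fg cg.
have cre : cvgn (series (fun n => re (f n))).
  by apply: real_series_dominated cg => n; apply: le_trans (fg n);
    exact: normc_ge_re.
have cim : cvgn (series (fun n => im (f n))).
  by apply: real_series_dominated cg => n; apply: le_trans (fg n);
    exact: normc_ge_im.
apply/cvg_ex; eexists; apply: cvg_complex; rewrite ?re_series ?im_series.
  exact: cre.
exact: cim.
Qed.

Lemma re_lim_series (R : realType) (f : nat -> R[i]^o) :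
  cvgn (series f) -> re (limn (series f)) = limn (series (fun n => re (f n))).
Proof.
move=> cf; apply/esym/cvg_lim => //; rewrite -re_series.
exact: cvg_re.
Qed.

Lemma normc_lim_series (R : realType) (f : nat -> R[i]^o) (g : nat -> R) :
  (forall n, normc (f n) <= g n) -> cvgn (series g) ->
  normc (limn (series f)) <= limn (series g).
Proof.
move=> fg cg; have /cvg_normcP cf := series_dominated fg cg.
apply/ler_addgt0Pr => e e0; set l := limn _ in cf *.
have [N _ /(_ _ (leqnn _)) lN] := cf _ e0.
have gN : series g N <= limn (series g).
  apply: (nondecreasing_cvgn_le _ cg N); apply: nondecreasing_series => n _ _.
  by apply: le_trans (fg n); exact: normc_ge0.
rewrite -(subrK (series f N) l) (le_trans (normcD _ _)) // addrC lerD //;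
  last exact: ltW.
apply: le_trans gN; rewrite /series /=.
elim/big_ind2: _ => [|x1 x2 y1 y2 h1 h2|i _] //; first by rewrite normc0.
by rewrite (le_trans (normcD _ _)) ?lerD.
Qed.

(** * The complex exponential and points of the unit circle *)

(** A remainder bounded by [K * |h|^2] forces differentiability; unlike a
    little-o remainder, such a bound can be summed over a series. *)
Lemma derivable_quadratic (R : realType) (f : R[i]^o -> R[i]^o) (z D : R[i]^o)
    (K d : R) : 0 < d ->
  (forall h, normc h < d ->
    normc (f (h + z) - f z - h * D) <= K * normc h ^+ 2) ->
  derivable f z 1.
Proof.
move=> d0 fK; apply/cvg_ex; exists D; apply/cvg_normcP => e e0.
have K1 : 0 < `|K| + 1 by rewrite ltr_wpDl.
have near_normc (r : R) : 0 < r -> \forall h \near (0 : R[i]^o)^', normc h < r.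
  by rewrite -ltcR => /(@dnbhs0_lt _ R[i]^o); apply: filterS => h;
    rewrite normc_normr ltcR.
near=> h => /=.
have h0 : h != 0 by near: h; exact: nbhs_dnbhs_neq.
have hd : normc h < d by near: h; exact: near_normc.
have he : normc h < e / (`|K| + 1).
  by near: h; apply: near_normc; rewrite divr_gt0.
have -> : h *: (1 : R[i]^o) = h by exact: mulr1.
have -> : D - h^-1 *: (f (h + z) - f z) = - (h^-1 * (f (h + z) - f z - h * D)).
  by rewrite [in RHS]mulrBr mulKf // opprB.
rewrite (@normcN R) normcM normcV mulrC.
have nh : 0 < normc h by rewrite normc_gt0.
rewrite ltr_pdivrMr // (le_lt_trans (fK _ hd)) // expr2 mulrA ltr_pM2r //.
move: he; rewrite ltr_pdivlMr //; apply: le_lt_trans.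
by rewrite mulrC ler_wpM2l ?normc_ge0 // (le_trans (ler_norm _)) // lerDl.
Unshelve. all: by end_near. Qed.

(** The mean value theorem between [0] and [y], with [c] bounded so that
    [cos c] can in turn be compared with [1]. *)
Lemma sin_mean (R : realType) (y : R) :
  exists2 c, `|c| <= `|y| & sin y = cos c * y.
Proof.
wlog y0 : y / 0 <= y => [th|].
  have [/th //|/ltW y0] := leP 0 y.
  have /th[c cy sy] : 0 <= - y by rewrite oppr_ge0.
  by exists c; rewrite -?[`|y|]normrN // -[y in sin y]opprK sinN sy mulrN opprK.
have [|c] := @MVT_segment R sin cos 0 y y0 (fun x _ => is_derive_sin x).
  by apply: continuous_subspaceT; exact: continuous_sin.
rewrite in_itv /= sin0 !subr0 => /andP[c0 cy] sy; exists c => //.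
by rewrite !ger0_norm.
Qed.

Lemma sin_le_norm (R : realType) (y : R) : `|sin y| <= `|y|.
Proof.
have [c _ ->] := sin_mean y.
by rewrite normrM ler_piMl // cos_max.
Qed.

Lemma one_minus_cosE (R : realType) (y : R) : 1 - cos y = 2 * sin (y / 2) ^+ 2.
Proof.
rewrite [y in LHS]splitr cosD -!expr2.
by have /eqP := cos2Dsin2 (y / 2); rewrite -subr_eq0 => /eqP ?; lra.
Qed.

Lemma sqr_le_norm (R : realType) (a b : R) : `|a| <= `|b| -> a ^+ 2 <= b ^+ 2.
Proof.
move=> ab; rewrite -(@real_normK _ a) ?num_real //.
by rewrite -(@real_normK _ b) ?num_real // ler_sqr ?nnegrE.
Qed.

Lemma one_minus_cos_le (R : realType) (y : R) : `|1 - cos y| <= y ^+ 2 / 2.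
Proof.
rewrite one_minus_cosE ger0_norm; last by rewrite mulr_ge0 // sqr_ge0.
have := sqr_le_norm (sin_le_norm (y / 2)); rewrite expr_div_n.
by lra.
Qed.

Lemma expR_quadratic (R : realType) (x : R) : `|x| <= 1 / 2 ->
  `|expR x - 1 - x| <= 2 * x ^+ 2.
Proof.
rewrite ler_norml => /andP[x1 x2].
have x3 := expR_ge1Dx x; have x4 := expR_ge1Dx (- x).
have x5 := expRxMexpNx_1 x; have := expR_gt0 x.
move: x3 x4 x5; move: (expR x) (expR (-x)) => u v x3 x4 x5 u0.
rewrite ger0_norm; last by lra.
(* The upper bound on [u = expR x] comes from [expR (- x) >= 1 - x]. *)
have : u * (1 - x) <= 1 by nra.
have : 0 <= x ^+ 2 * (1 - 2 * x) by rewrite mulr_ge0 ?sqr_ge0 //; lra.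
by nra.
Qed.

Lemma cexp_quadratic (R : realType) (h : R[i]^o) : normc h <= 1 / 2 ->
  normc (cexp h - 1 - h) <= 10 * normc h ^+ 2.
Proof.
move=> h2; have hx := normc_ge_re h; have hy := normc_ge_im h.
apply: le_trans (normc_le_reim _) _; move: hx hy h2; move: (normc h) => n.
case: h => x y; rewrite /cexp /= !mul0r !subr0 !addr0 => hx hy n2.
have ex : `|expR x - 1 - x| <= 2 * x ^+ 2 by apply: expR_quadratic; lra.
have cy := one_minus_cos_le y.
have sy := sin_le_norm y.
have [c cc sc] := sin_mean y.
have ccos := one_minus_cos_le c.
have n0 : 0 <= n by apply: le_trans hx.
have xn : x ^+ 2 <= n ^+ 2 by apply: sqr_le_norm; rewrite (ger0_norm n0).
have yn : y ^+ 2 <= n ^+ 2 by apply: sqr_le_norm; rewrite (ger0_norm n0).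
have cn : c ^+ 2 <= y ^+ 2 by apply: sqr_le_norm.
have ex1 : `|expR x - 1| <= 2 * n.
  have : `|expR x - 1| <= `|expR x - 1 - x| + `|x|.
    by rewrite -[X in `|X| <= _](subrK x) ler_normD.
  by nra.
have ex2 : expR x <= 2 by move: ex1; rewrite ler_norml; lra.
have e0 := expR_ge0 x.
have -> : expR x * cos y - 1 - x = (expR x - 1 - x) - expR x * (1 - cos y).
  by ring.
have -> : expR x * sin y - y = (expR x - 1) * sin y + (cos c - 1) * y.
  by rewrite sc; ring.
have a1 : `|expR x - 1 - x - expR x * (1 - cos y)| <= 3 * n ^+ 2.
  rewrite (le_trans (ler_normB _ _)) // normrM (ger0_norm e0).
  have : expR x * `|1 - cos y| <= 2 * (y ^+ 2 / 2) by rewrite ler_pM.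
  by lra.
have a2 : `|(expR x - 1) * sin y + (cos c - 1) * y| <= 3 * n ^+ 2.
  rewrite (le_trans (ler_normD _ _)) // !normrM -[cos c - 1]opprB normrN.
  have : `|expR x - 1| * `|sin y| <= 2 * n * n.
    by rewrite ler_pM // (le_trans sy).
  have : `|1 - cos c| * `|y| <= n ^+ 2 / 2 * n by rewrite ler_pM //; lra.
  by nra.
by nra.
Qed.

Lemma cexpD (R : realType) (z w : R[i]^o) : cexp (z + w) = cexp z * cexp w.
Proof.
case: z w => a b [c d]; rewrite /cexp /=.
rewrite expRD cosD sinD rmorphM /= mulrACA; congr (_ * _).
by apply/eqP; rewrite eq_complex /= eqxx /= addrC.
Qed.

Lemma normc_cexp (R : realType) (z : R[i]^o) : normc (cexp z) = expR (re z).
Proof.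
rewrite /cexp normcM normc_real ger0_norm ?expR_ge0 //=.
by rewrite cos2Dsin2 sqrtr1 mulr1.
Qed.

Lemma derivable_cexp (R : realType) (z : R[i]^o) : derivable (@cexp R) z 1.
Proof.
apply: (@derivable_quadratic _ _ _ (cexp z) (10 * normc (cexp z)) (1 / 2)).
  by lra.
move=> h /ltW hh.
have -> : cexp (h + z) - cexp z - h * cexp z = cexp z * (cexp h - 1 - h).
  by rewrite cexpD !mulrBr mulr1 [cexp h * _]mulrC [h * _]mulrC.
rewrite normcM [10 * _]mulrC -mulrA ler_wpM2l ?normc_ge0 //.
exact: cexp_quadratic.
Qed.

Lemma continuous_cexp (R : realType) : continuous (@cexp R).
Proof.
by move=> z; apply/differentiable_continuous/derivable1_diffP/derivable_cexp.
Qed.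

Lemma cisE (R : realType) (t : R) : cis t = (cos t +i* sin t)%C.
Proof. by rewrite /cis /cexp /= expR0 mul1r. Qed.

Lemma normc_cis (R : realType) (t : R) : normc (cis t) = 1.
Proof. by rewrite /cis normc_cexp expR0. Qed.

Lemma chord_sqr (R : realType) (a b : R) :
  normc (cis a - cis b) ^+ 2 = 2 * (1 - cos (a - b)).
Proof.
rewrite normc_sqr !cisE /= cosB.
by have := cos2Dsin2 a; have := cos2Dsin2 b; lra.
Qed.

Lemma chord_le (R : realType) (a b : R) : normc (cis a - cis b) <= `|a - b|.
Proof.
rewrite -ler_sqr ?nnegrE ?normc_ge0 // chord_sqr real_normK ?num_real //.
by have := one_minus_cos_le (a - b); rewrite ler_norml; lra.
Qed.

Lemma cis_inj (R : realType) (a b : R) : 0 <= a < 2 * pi -> 0 <= b < 2 * pi ->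
  cis a = cis b -> a = b.
Proof.
wlog ab : a b / a <= b => [th ra rb E|ra rb E].
  have [ab|/ltW ba] := leP a b; first exact: th.
  by apply/esym/th.
apply/eqP; case: eqVneq => // nab.
have := chord_sqr b a; rewrite E subrr normc0 expr0n /= one_minus_cosE.
suff : 0 < sin ((b - a) / 2) by move=> /(exprn_gt0 2); lra.
apply: sin_gt0_pi; have : a < b by rewrite lt_neqAle nab.
by lra.
Qed.

(** * Herglotz kernels and their sums *)

Definition herglotz (F : fieldType) (e z : F) : F := (z + e) / (z - e).

Lemma herglotzB (F : fieldType) (e z w : F) : z != e -> w != e ->
  herglotz e w - herglotz e z = - (2 * e * (w - z)) / ((w - e) * (z - e)).
Proof.
rewrite -subr_eq0 -[w == e]subr_eq0 => ze we.
by rewrite /herglotz; field; rewrite ze we.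
Qed.

Lemma herglotz_taylor (F : fieldType) (e z h : F) : z != e -> h + z != e ->
  herglotz e (h + z) - herglotz e z - h * (- (2 * e) / (z - e) ^+ 2) =
  2 * e * h ^+ 2 / ((h + z - e) * (z - e) ^+ 2).
Proof.
rewrite -subr_eq0 -[h + z == e]subr_eq0 => ze we.
by rewrite /herglotz; field; rewrite ze we.
Qed.

Definition poisson (R : realType) (e z : R[i]) : R :=
  (1 - normc z ^+ 2) / normc (z - e) ^+ 2.

Lemma re_herglotz (R : realType) (e z : R[i]) : normc e = 1 ->
  re (herglotz e z) = - poisson e z.
Proof.
move=> e1; rewrite /poisson /herglotz -[1](expr1n _ 2) -e1 !normc_sqr !raddfB.
case: e z {e1} => a b [x y] /=.
set d := _ ^+ 2 + _ ^+ 2.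
by ring.
Qed.

Section HerglotzSeries.
Context {R : realType} (e : nat -> R[i]^o) (g : nat -> R).
Hypothesis e1 : forall n, normc (e n) = 1.
Hypothesis g0 : forall n, 0 <= g n.
Hypothesis cg : cvgn (series g).

Definition herglotz_sum (z : R[i]^o) : R[i]^o :=
  limn (series (fun n => (g n)%:C * herglotz (e n) z : R[i]^o)).

(** The closed disc is allowed because radial limits need the Herglotz sum at
    boundary points as well. *)
Definition separated_from (d : R) (z : R[i]^o) : Prop :=
  normc z <= 1 /\ forall n, d <= normc (z - e n).

Lemma cvg_series_scale (K : R) : cvgn (series (fun n => g n * K)).
Proof.
by under eq_fun do rewrite mulrC; exact: (@is_cvg_seriesZ R g K cg).
Qed.

Lemma lim_series_scale (K : R) :
  limn (series (fun n => g n * K)) = limn (series g) * K.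
Proof.
under eq_fun do rewrite mulrC; rewrite mulrC; exact: (@lim_seriesZ R g K cg).
Qed.

Lemma normc_scaled_le n (w : R[i]) (K : R) : normc w <= K ->
  normc ((g n)%:C * w) <= g n * K.
Proof. by move=> wK; rewrite normcM normc_real ger0_norm // ler_wpM2l. Qed.

Lemma herglotz_series_cvg d z : 0 < d -> separated_from d z ->
  cvgn (series (fun n => (g n)%:C * herglotz (e n) z : R[i]^o)).
Proof.
move=> d0 [z1 dz]; apply: (series_dominated _ (cvg_series_scale (K := 2 / d))).
move=> n; apply: normc_scaled_le; rewrite normcM normcV ler_pM ?invr_ge0 ?normc_ge0 //.
  by rewrite (le_trans (normcD _ _)) // e1; lra.
by rewrite lef_pV2 // posrE // (lt_le_trans d0).
Qed.

Lemma separated_neq d z n : 0 < d -> separated_from d z -> z != e n.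
Proof.
by move=> d0 [_ /(_ n)] dz; rewrite -subr_eq0 -normc_gt0 (lt_le_trans d0).
Qed.

(** Each kernel has Lipschitz constant [2 / d ^+ 2] off the disc of radius [d]
    about its pole, and these constants are summed with weights [g]. *)
Lemma herglotz_sum_lipschitz d z w : 0 < d ->
  separated_from d z -> separated_from d w ->
  normc (herglotz_sum w - herglotz_sum z) <=
  limn (series g) * (2 / d ^+ 2 * normc (w - z)).
Proof.
move=> d0 sz sw; rewrite /herglotz_sum.
rewrite -(lim_seriesB (herglotz_series_cvg d0 sw) (herglotz_series_cvg d0 sz)).
rewrite -lim_series_scale; apply: normc_lim_series;
  last exact: cvg_series_scale.
move=> n; have -> : ((fun n => (g n)%:C * herglotz (e n) w : R[i]^o) -
    (fun n => (g n)%:C * herglotz (e n) z : R[i]^o)) n =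
    (g n)%:C * (herglotz (e n) w - herglotz (e n) z) by rewrite mulrBr.
apply: normc_scaled_le.
rewrite herglotzB ?(separated_neq n d0) // mulNr (@normcN R).
rewrite !normcM normcV normc2 e1 mulr1 normcM mulrAC.
rewrite ler_wpM2r ?normc_ge0 // ler_wpM2l // lef_pV2 ?posrE.
- by rewrite expr2 ler_pM ?(ltW d0) //; [case: sw|case: sz].
- by rewrite mulr_gt0 // normc_gt0 subr_eq0 (separated_neq _ d0).
- exact: exprn_gt0.
Qed.

Lemma separated_disc z : normc z < 1 -> separated_from (1 - normc z) z.
Proof.
move=> z1; split=> [|n]; first exact: ltW.
by rewrite lerBlDr -(e1 n) -[e n in leLHS](subrK z) (le_trans (normcD _ _)) //
  normcB.
Qed.

(** Half of the distance [1 - |z|] to the circle is kept, so that all the points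
    [h + z] with [|h| < d] stay at distance at least [d] from every pole; the
    termwise Taylor remainders are then summed. *)
Lemma derivable_herglotz_sum z : normc z < 1 -> derivable herglotz_sum z 1.
Proof.
move=> z1; pose d := (1 - normc z) / 2.
have d0 : 0 < d by rewrite divr_gt0 // subr_gt0.
pose D n : R[i]^o := (g n)%:C * (- (2 * e n) / (z - e n) ^+ 2).
have sz : separated_from d z.
  have [? sz] := separated_disc z1; split=> // n; apply: le_trans (sz n).
  by rewrite /d; lra.
apply: (@derivable_quadratic _ _ _ (limn (series D))
  (limn (series g) * (2 / d ^+ 3)) d) => // h hd.
have hz : normc (h + z) <= 1 - d.
  by rewrite (le_trans (normcD _ _)) //; move: hd; rewrite /d; lra.
have sh : separated_from d (h + z).
  have hz1 : normc (h + z) < 1 by lra.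
  have [? sh] := separated_disc hz1; split=> // n; apply: le_trans (sh n).
  by lra.
have cD : cvgn (series D).
  apply: (series_dominated _ (cvg_series_scale (K := 2 / d ^+ 2))) => n.
  apply: normc_scaled_le; rewrite mulNr (@normcN R) normcM normcV normcX.
  rewrite normcM normc2 e1 mulr1 ler_wpM2l // lef_pV2 ?posrE ?exprn_gt0 //.
    by rewrite lerXn2r ?nnegrE ?normc_ge0 ?(ltW d0) //; case: sz.
  by rewrite normc_gt0 subr_eq0 (separated_neq _ d0).
have ch := herglotz_series_cvg d0 sh; have cz := herglotz_series_cvg d0 sz.
have -> : h * limn (series D) = limn (series (fun n => h * D n : R[i]^o)).
  by rewrite (@lim_seriesZ R[i] D h cD).
have chD : cvgn (series (fun n => h * D n : R[i]^o)).
  exact: (@is_cvg_seriesZ R[i] D h cD).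
have cB := is_cvg_seriesB ch cz.
rewrite /herglotz_sum -(lim_seriesB ch cz) -(lim_seriesB cB chD).
rewrite -mulrA -lim_series_scale.
apply: normc_lim_series; last exact: cvg_series_scale.
move=> n; have -> : ((fun n => (g n)%:C * herglotz (e n) (h + z) : R[i]^o) -
    (fun n => (g n)%:C * herglotz (e n) z : R[i]^o) - (fun n => h * D n)) n =
    (g n)%:C * (herglotz (e n) (h + z) - herglotz (e n) z -
      h * (- (2 * e n) / (z - e n) ^+ 2)).
  by rewrite [RHS]mulrBr [in RHS]mulrBr (mulrCA (g n)%:C h).
apply: normc_scaled_le.
rewrite herglotz_taylor ?(separated_neq n d0) //.
rewrite normcM normcV (normcM (2 * _)) (normcM 2) (normcM (h + z - _)).
rewrite !normcX normc2 e1 mulr1 mulrAC.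
rewrite ler_wpM2r ?exprn_ge0 ?normc_ge0 // ler_wpM2l // lef_pV2 ?posrE.
- rewrite exprS ler_pM ?exprn_ge0 ?(ltW d0) //; first by case: sh.
  by rewrite lerXn2r ?nnegrE ?normc_ge0 ?(ltW d0) //; case: sz.
- by rewrite mulr_gt0 ?exprn_gt0 // normc_gt0 subr_eq0 (separated_neq _ d0).
- exact: exprn_gt0.
Qed.

Let re_scaled_herglotz n z :
  re ((g n)%:C * herglotz (e n) z) = - (g n * poisson (e n) z).
Proof.
by rewrite -mulrN -re_herglotz //; case: (herglotz _ _) => a b /=;
  rewrite mul0r subr0.
Qed.

Lemma poisson_series_cvg d z : 0 < d -> separated_from d z ->
  cvgn (series (fun n => g n * poisson (e n) z)).
Proof.
move=> d0 sz; rewrite -is_cvg_seriesN.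
have -> : - (fun n => g n * poisson (e n) z) =
    (fun n => re ((g n)%:C * herglotz (e n) z)).
  by apply/funext => n; rewrite re_scaled_herglotz.
rewrite -re_series; apply: cvgP; apply: cvg_re.
exact: herglotz_series_cvg sz.
Qed.

Lemma re_herglotz_sum d z : 0 < d -> separated_from d z ->
  re (herglotz_sum z) = - limn (series (fun n => g n * poisson (e n) z)).
Proof.
move=> d0 sz; rewrite re_lim_series; last exact: herglotz_series_cvg sz.
rewrite -lim_seriesN; last exact: poisson_series_cvg sz.
by congr (limn (series _)); apply/funext => n; exact: re_scaled_herglotz.
Qed.

End HerglotzSeries.

(** * Poisson kernels along a radius *)

(** Let [rho = |z|], let [p] be the real inner product of [z] and [e], and
    [n = t^2 rho^2].  The kernel can be larger at [z] than at [t z] only if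
    [p (1 + n) > 2 t rho^2], and this inequality bounds
    [|t z - e|^2 = 1 - 2 t p + n] by [(1 - n)^2]. *)
Lemma radial_alternative (R : realType) (e z : R[i]) (t : R) :
  normc e = 1 -> normc z < 1 -> 0 <= t <= 1 ->
  poisson e z <= poisson e (t%:C * z) \/
  normc (t%:C * z - e) <= 1 - normc (t%:C * z) ^+ 2.
Proof.
move=> e1 z1 /andP[t0 t1].
have e2 : re e ^+ 2 + im e ^+ 2 = 1 by rewrite -normc_sqr e1 expr1n.
pose p := re z * re e + im z * im e.
have dist (s : R) : normc (s%:C * z - e) ^+ 2 =
    1 - 2 * (s * p) + s ^+ 2 * normc z ^+ 2.
  rewrite !normc_sqr !raddfB /p; move: e2; clear.
  by case: e z => a b [x y] /= e2; lra.
have nt : normc (t%:C * z) ^+ 2 = t ^+ 2 * normc z ^+ 2.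
  by rewrite normcZ exprMn real_normK ?num_real.
have distz : normc (z - e) ^+ 2 = 1 - 2 * p + normc z ^+ 2.
  by have := dist 1; rewrite rmorph1 !mul1r expr1n mul1r.
have rho1 : normc z ^+ 2 < 1 by rewrite expr_lt1 // normc_ge0.
have rho0 : 0 <= normc z ^+ 2 by exact: sqr_ge0.
have dgt0 (w : R[i]) : normc w < 1 -> 0 < normc (w - e) ^+ 2.
  move=> w1; rewrite exprn_gt0 // normc_gt0 subr_eq0.
  by apply: contraTneq w1 => ->; rewrite e1 ltxx.
have tz1 : normc (t%:C * z) < 1.
  by rewrite normcZ ger0_norm // (le_lt_trans _ z1) // ler_piMl ?normc_ge0.
have [pt|pt] := leP (p * (1 + t ^+ 2 * normc z ^+ 2)) (2 * t * normc z ^+ 2).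
  left; rewrite /poisson ler_pdivrMr ?dgt0 // mulrAC ler_pdivlMr ?dgt0 //.
  rewrite dist distz nt; move: rho0 rho1 pt; move: (normc z ^+ 2) => r r0 r1 pt.
  rewrite -subr_ge0.
  have -> : (1 - t ^+ 2 * r) * (1 - 2 * p + r) -
      (1 - r) * (1 - 2 * (t * p) + t ^+ 2 * r) =
      2 * (1 - t) * (r * (1 + t) - p * (1 + t * r)) by ring.
  rewrite !mulr_ge0 // ?subr_ge0 //.
  have tr0 : 0 <= t * r by rewrite mulr_ge0.
  have [p0|p0] := leP p 0.
    rewrite (@le_trans _ _ 0) ?mulr_le0_ge0 ?mulr_ge0 ?addr_ge0 //.
  (* The hypothesis [pt] is used after multiplying the goal by this factor. *)
  have t2r : 0 < 1 + t ^+ 2 * r by rewrite ltr_wpDr // mulr_ge0 // sqr_ge0.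
  rewrite -(ler_pM2r t2r).
  have : p * (1 + t ^+ 2 * r) * (1 + t * r) <= 2 * t * r * (1 + t * r).
    by rewrite ler_wpM2r // addr_ge0.
  have : 0 <= r * ((1 - t) * (1 - t ^+ 2 * r)).
    rewrite !mulr_ge0 ?subr_ge0 // mulr_ile1 ?sqr_ge0 // ?expr_le1 //.
    exact: ltW.
  by lra.
right; have nt1 : normc (t%:C * z) ^+ 2 < 1 by rewrite expr_lt1 // normc_ge0.
rewrite -ler_sqr ?nnegrE ?normc_ge0 ?subr_ge0 ?(ltW nt1) //.
have := ler_wpM2l t0 (ltW pt).
have -> : t * (2 * t * normc z ^+ 2) = 2 * normc (t%:C * z) ^+ 2.
  by rewrite nt; ring.
rewrite dist -nt; have := sqr_ge0 (normc (t%:C * z)).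
move: nt1; move: (normc (t%:C * z) ^+ 2) => n n1 n0 ptn.
have n2 : 0 < 1 + n by rewrite ltr_wpDr.
(* Times [1 + n]: [(1 + n)^2 - 4 n = (1 - n)^2 <= (1 - n)^2 (1 + n)]. *)
rewrite -(ler_pM2r n2).
have : 0 <= n * (1 - n) ^+ 2 by rewrite mulr_ge0 ?sqr_ge0.
by nra.
Qed.

Lemma poisson_lower (R : realType) (e w : R[i]) :
  normc e = 1 -> normc w < 1 ->
  normc (w - e) <= 2 * (1 - normc w ^+ 2) ->
  (4 * (1 - normc w ^+ 2))^-1 <= poisson e w.
Proof.
move=> e1 w1; have w2 : normc w ^+ 2 < 1 by rewrite expr_lt1 // normc_ge0.
have d0 : 0 < normc (w - e).
  by rewrite normc_gt0 subr_eq0; apply: contraTneq w1 => ->; rewrite e1 ltxx.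
rewrite /poisson; move: w2 d0;
  move: (normc (w - e)) (normc w ^+ 2) => d n n1 d0 dn.
have q0 : 0 < 1 - n by rewrite subr_gt0.
rewrite ler_pdivlMr ?exprn_gt0 // mulrC ler_pdivrMr ?mulr_gt0 //.
have : d ^+ 2 <= (2 * (1 - n)) ^+ 2.
  by rewrite ler_sqr ?nnegrE ?(ltW d0) // mulr_ge0 // ltW.
by lra.
Qed.

(** * Mass of the atoms near a point *)

Lemma positive_uniform_lower (R : realType) (f : nat -> R) (d : R) :
  (forall n, 0 < f n) -> 0 < d -> (\forall n \near \oo, d <= f n) ->
  exists2 c, 0 < c & forall n, c <= f n.
Proof.
move=> f0 d0 [N _ dN].
have [c c0 cN] : exists2 c, 0 < c & forall n, (n < N)%N -> c <= f n.
  elim: N {dN} => [|N [c c0 cN]]; first by exists 1.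
  exists (Num.min c (f N)); first by rewrite lt_min c0 f0.
  move=> n; rewrite ltnS leq_eqVlt => /predU1P[->|/cN cn];
    rewrite ge_min ?lexx ?orbT //.
  by rewrite cn.
exists (Num.min c d); first by rewrite lt_min c0 d0.
move=> n; rewrite ge_min; have [/cN ->//|/dN /= ->] := ltnP n N.
exact: orbT.
Qed.

(** Eventually
    [theta n - theta n.+1 <= theta n.-1 - theta n.+1 <= C * gamma n ^+ 2], and one factor [gamma n] is absorbed by the total mass.  The finitely many
    remaining indices only change the constant. *)
Lemma gap_linear (R : realType) (theta gamma : nat -> R) (C : R) :
  (forall n, 0 < gamma n) -> cvgn (series gamma) ->
  (forall n, (1 <= n)%N -> theta n.+1 < theta n) -> 0 < C ->
  (\forall n \near \oo, `|theta n.-1 - theta n.+1| <= C * gamma n ^+ 2) ->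
  exists2 K, 0 < K & forall n, (1 <= n)%N ->
    K * (theta n - theta n.+1) <= gamma n.
Proof.
move=> g0 cg decr C0 [N _ gap].
have gap_gt0 n : 0 < theta n.+1 - theta n.+2 by rewrite subr_gt0 decr.
pose G := limn (series gamma).
have gG n : gamma n <= G.
  apply: le_trans (nondecreasing_cvgn_le _ cg n.+1).
    by rewrite seriesEnat /= big_nat_recr //= lerDr sumr_ge0 // => i _;
      exact: ltW.
  by apply: nondecreasing_series => i _ _; exact: ltW.
have G0 : 0 < G := lt_le_trans (g0 0%N) (gG 0%N).
have CG : 0 < C * G by rewrite mulr_gt0.
have [|||K K0 KP] := @positive_uniform_lower _
    (fun n => gamma n.+1 / (theta n.+1 - theta n.+2)) (C * G)^-1.
- by move=> n; rewrite divr_gt0.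
- by rewrite invr_gt0.
- exists N.+1 => // -[//|n] /= Nn.
  rewrite ler_pdivlMr // mulrC ler_pdivrMr //.
  have := gap n.+2 (leqW (leqW (Nn : (N <= n)%N)));
    rewrite /= => /(le_trans (ler_norm _)) gapn.
  have dn := decr n.+1 isT.
  have : theta n.+2 - theta n.+3 <= C * gamma n.+2 ^+ 2 by lra.
  move=> /le_trans; apply; rewrite expr2 mulrA mulrC ler_wpM2l ?(ltW (g0 _)) //.
  by rewrite ler_wpM2l // ltW.
exists K => // -[//|n] _.
by have := KP n; rewrite ler_pdivlMr.
Qed.

(** At a point [w] within [q = 1 - |w|^2] of an atom, the atoms within [2 q] of
    [w] carry a mass comparable to [q], and each unit of that mass contributes
    at least [1 / (4 q)]. *)
Lemma potential_ge_near_atom (R : realType) (theta gamma : nat -> R) (K : R) :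
  (forall n, 0 < gamma n) ->
  theta 0%N = 0 -> (forall n, (1 <= n)%N -> 0 < theta n) ->
  (forall n, (1 <= n)%N -> theta n.+1 < theta n) -> theta @ \oo --> 0 ->
  0 < K -> (forall n, (1 <= n)%N -> K * (theta n - theta n.+1) <= gamma n) ->
  forall (w : R[i]^o) m, normc w < 1 ->
    cvgn (series (fun n => gamma n * poisson (cis (theta n)) w)) ->
    normc (w - cis (theta m)) <= 1 - normc w ^+ 2 ->
  Num.min (gamma 0%N) K / 4 <=
    limn (series (fun n => gamma n * poisson (cis (theta n)) w)).
Proof.
move=> g0 th0 thpos decr cth K0 gap w m w1; set u := fun n => _ => cu wm.
pose q := 1 - normc w ^+ 2; rewrite -/q in wm.
have q0 : 0 < q by rewrite subr_gt0 expr_lt1 // normc_ge0.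
have q1 : q <= 1 by rewrite lerBlDr lerDl sqr_ge0.
have P0 n : 0 <= poisson (cis (theta n)) w.
  by rewrite divr_ge0 ?sqr_ge0 // ltW.
have u0 n : 0 <= u n by rewrite mulr_ge0 // ltW.
have near_lower n : `|theta m - theta n| <= q -> gamma n * (4 * q)^-1 <= u n.
  move=> mn; rewrite ler_wpM2l ?(ltW (g0 _)) //.
  apply: poisson_lower => //; first exact: normc_cis.
  rewrite (le_trans (normcBD (cis (theta m)) _ _)) // mulr2n mulrDl mul1r.
  rewrite lerD //.
  exact: le_trans (chord_le _ _) mn.
have partial n : series u n <= limn (series u).
  by apply: (nondecreasing_cvgn_le _ cu n);
    apply: nondecreasing_series => i _ _.
(* If [theta m <= q], the atom at [1] is close enough to [w] by itself. *)
have [mq|qm] := leP (theta m) q.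
  have thm0 : 0 <= theta m.
    by case: (m) => [|k]; [rewrite th0|exact/ltW/thpos].
  apply: le_trans (partial 1%N); rewrite seriesEnat /= big_nat1.
  have mq0 : `|theta m - theta 0%N| <= q by rewrite th0 subr0 ger0_norm.
  apply: le_trans (near_lower 0%N mq0).
  rewrite ler_pM ?invr_ge0 ?ge_min ?lexx //.
  - by rewrite le_min !ltW.
  - by rewrite lef_pV2 ?posrE ?mulr_gt0 //; lra.
have m1 : (1 <= m)%N.
  by rewrite lt0n; apply: contraTneq qm => ->; rewrite th0 -leNgt ltW.
(* The atoms of index [k] with [m <= k < b] are those with angle in
   [[theta m - q, theta m]]; they are finitely many since [theta m - q > 0]. *)
have ex_b : exists n, (m <= n)%N && (theta n < theta m - q).
  have d0 : 0 < theta m - q by rewrite subr_gt0.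
  have /cvgrPdist_lt /(_ _ d0) [N _ thN] := cth.
  exists (maxn m N); rewrite leq_maxl /=.
  have := thN (maxn m N) (leq_maxr _ _); rewrite sub0r normrN.
  exact/le_lt_trans/ler_norm.
have [b /andP[mb bq] bmin] := ex_minnP ex_b.
have mono k : (m <= k)%N -> theta k <= theta m.
  elim: k => [|k IH]; first by rewrite leqn0 => /eqP ->.
  rewrite leq_eqVlt => /predU1P[-> //|mk]; apply: le_trans (IH mk).
  by rewrite ltW // decr // (leq_trans m1).
have block k : (m <= k < b)%N -> `|theta m - theta k| <= q.
  move=> /andP[mk kb]; rewrite ger0_norm ?subr_ge0 ?mono //.
  rewrite lerBlDr -lerBlDl leNgt; apply/negP => kq.
  by have := bmin k; rewrite mk kq /= => /(_ isT); rewrite leqNgt kb.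
(* Discard all the terms outside the block and telescope the gaps. *)
apply: le_trans (partial b).
have -> : series u b = series u m + \sum_(m <= k < b) u k.
  by rewrite -sub_series_geq // addrC subrK.
have um0 : 0 <= series u m by rewrite seriesEnat sumr_ge0.
rewrite (@le_trans _ _ (\sum_(m <= k < b) u k)) ?lerDr //.
have : \sum_(m <= k < b) K * (theta k - theta k.+1) * (4 * q)^-1 <=
       \sum_(m <= k < b) u k.
  rewrite big_nat_cond [leRHS]big_nat_cond.
  apply: ler_sum => k /andP[mkb _];
    apply: le_trans (near_lower _ (block _ mkb)).
  rewrite ler_wpM2r ?invr_ge0 ?mulr_ge0 ?(ltW q0) // gap //.
  by case/andP: mkb => mk _; exact: leq_trans m1 mk.
apply: le_trans; rewrite -mulr_suml -mulr_sumr.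
have -> : \sum_(m <= k < b) (theta k - theta k.+1) = theta m - theta b.
  rewrite -[RHS]opprB -telescope_sumr // -sumrN.
  by apply: eq_bigr => k _; rewrite opprB.
rewrite invfM mulrA ler_pdivlMr // mulrAC ler_wpM2r ?invr_ge0 //.
apply: ler_pM; rewrite ?(ltW q0) ?ge_min ?lexx ?orbT //.
  by rewrite le_min !ltW.
by lra.
Qed.

(** * The atomic singular inner function *)

Section AtomicSingular.
Context {R : realType} (theta gamma : nat -> R).
Hypothesis gamma_gt0 : forall n, 0 < gamma n.
Hypothesis gamma_summable : cvgn (series gamma).

Let e n : R[i]^o := cis (theta n).
Let e1 n : normc (e n) = 1. Proof. exact: normc_cis. Qed.
Let gamma_ge0 n : 0 <= gamma n. Proof. exact: ltW. Qed.

Lemma atomic_singularE z :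
  atomic_singular theta gamma z = cexp (herglotz_sum e gamma z).
Proof. by []. Qed.

Lemma unit_discE (z : R[i]^o) : unit_disc z <-> normc z < 1.
Proof.
by rewrite /unit_disc /= normc_normr -(rmorph1 (real_complex R)) ltcR.
Qed.

Definition potential (z : R[i]^o) : R :=
  limn (series (fun n => gamma n * poisson (e n) z)).

Lemma potential_cvg z : normc z < 1 ->
  cvgn (series (fun n => gamma n * poisson (e n) z)).
Proof.
move=> z1.
apply: (poisson_series_cvg e1 gamma_ge0 gamma_summable (d := 1 - normc z)).
  by rewrite subr_gt0.
exact: separated_disc.
Qed.

Lemma normc_atomic_singular z : normc z < 1 ->
  normc (atomic_singular theta gamma z) = expR (- potential z).
Proof.
move=> z1; rewrite atomic_singularE normc_cexp.
rewrite (re_herglotz_sum e1 gamma_ge0 gamma_summable (d := 1 - normc z)) //.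
  by rewrite subr_gt0.
exact: separated_disc.
Qed.

Lemma potential_ge0 z : normc z < 1 -> 0 <= potential z.
Proof.
move=> z1; apply: limr_ge; first exact: potential_cvg.
apply: nearW => n; rewrite seriesEnat sumr_ge0 // => i _.
rewrite mulr_ge0 // divr_ge0 ?sqr_ge0 // subr_ge0 expr_le1 ?normc_ge0 //.
exact: ltW.
Qed.

Lemma bounded_analytic_atomic_singular :
  bounded_analytic (atomic_singular theta gamma).
Proof.
split=> [z /unit_discE z1|]; last first.
  exists 1 => z /unit_discE z1.
  rewrite normc_normr lecR normc_atomic_singular //.
  by rewrite -expR0 ler_expR oppr_le0 potential_ge0.
have -> : atomic_singular theta gamma = @cexp R \o herglotz_sum e gamma by [].
apply/derivable1_diffP/differentiable_comp; apply/derivable1_diffP.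
  exact: derivable_herglotz_sum.
exact: derivable_cexp.
Qed.

(** Since the atoms accumulate only at the atom [e 0], a boundary point that is
    not an atom keeps a distance [d] from all of them, and so do the points of
    its radius up to a factor [2]; so the Lipschitz bound holds up to the boundary, where the Poisson
    kernels vanish. *)
Lemma radial_limit_atomic_singular (t : R) :
  (forall n, cis t != e n) -> e @ \oo --> e 0%N ->
  exists l : R[i]^o, `|l| = 1 /\
    atomic_singular theta gamma (r%:C * cis t) @[r --> (1 : R)^'-] --> l.
Proof.
move=> te ce; pose z : R[i]^o := cis t.
have z1 : normc z = 1 by exact: normc_cis.
have dist_gt0 n : 0 < normc (z - e n) by rewrite normc_gt0 subr_eq0.
have [||d d0 dz] := @positive_uniform_lower _ (fun n => normc (z - e n))
    (normc (z - e 0%N) / 2) dist_gt0.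
- by rewrite divr_gt0.
- have /cvg_normcP /(_ (normc (z - e 0%N) / 2)) := ce.
  rewrite divr_gt0 // => /(_ isT); apply: filterS => n en.
  have := normcBD (e n) z (e 0%N); rewrite [X in _ <= _ + X -> _]normcB.
  by move: en; lra.
have d20 : 0 < d / 2 by rewrite divr_gt0.
have sz : separated_from e (d / 2) z.
  by split=> [|n]; [rewrite z1|apply: le_trans (dz n); lra].
exists (atomic_singular theta gamma z); split.
  rewrite normc_normr -(rmorph1 (real_complex R)); congr _%:C.
  rewrite atomic_singularE normc_cexp.
  rewrite (re_herglotz_sum e1 gamma_ge0 gamma_summable d20 sz).
  have -> : (fun n => gamma n * poisson (e n) z) = fun=> 0.
    by apply/funext => n; rewrite /poisson z1 expr1n subrr mul0r mulr0.
  have -> : series (fun=> 0 : R) = fun=> 0.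
    by apply/funext => n; rewrite seriesEnat /= big1.
  by rewrite lim_cst // oppr0 expR0.
apply: (@continuous_cvg _ _ _ _ _ _ (@cexp R)); first exact: continuous_cexp.
pose M := limn (series gamma) * (2 / (d / 2) ^+ 2).
apply: (cvg_normc_le (r := fun r => M * (1 - r))); last first.
  rewrite -[X in _ --> X](mulr0 M) -[X in M * X](subrr 1).
  apply: cvgMr; apply: cvgB; first exact: cvg_cst.
  exact: cvg_at_left_filter.
near=> r.
have r1 : r < 1 by near: r; exact: nbhs_left_lt.
have r0 : 0 < r by near: r; apply: nbhs_left_gt.
have rz : normc (z - r%:C * z) = 1 - r.
  rewrite -[X in X - _]mul1r -mulrBl -(rmorph1 (real_complex R)) -rmorphB.
  by rewrite normcZ z1 mulr1 ger0_norm // subr_ge0 ltW.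
have nrz : normc (r%:C * z) = r by rewrite normcZ z1 mulr1 gtr0_norm.
have srz : separated_from e (d / 2) (r%:C * z).
  (* [|z - r z| = 1 - r <= |r z - e n|], so
     [d <= |z - e n| <= 2 |r z - e n|]. *)
  split=> [|n]; first by rewrite nrz ltW.
  have := normcBD (r%:C * z) z (e n); rewrite rz.
  have := normcD (r%:C * z) (e n - r%:C * z).
  by rewrite addrC subrK e1 nrz (normcB (e n) (_ * _)); have := dz n; lra.
have := herglotz_sum_lipschitz e1 gamma_ge0 gamma_summable d20 srz sz.
by rewrite rz => /le_trans; apply; rewrite /M -[leRHS]mulrA.
Unshelve. all: by end_near. Qed.

End AtomicSingular.

(** * Connectedness of the level sets *)

Lemma star_shaped_connected (R : realType) (A : set R[i]^o) :
  (forall z t, A z -> 0 <= t <= 1 -> A (t%:C * z)) -> connected A.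
Proof.
move=> starA.
pose segment z := [set (t%:C * z : R[i]^o) | t in `[0, 1]].
have -> : A = (\bigcup_(z in A) segment z)%classic.
  apply/seteqP; split=> [z Az|_ [z Az [t /= t01 <-]]].
    by exists z => //; exists 1;
      rewrite /= ?in_itv /= ?ler01 ?lexx // rmorph1 mul1r.
  by apply: starA => //; rewrite in_itv in t01.
apply: bigcup_connected.
  exists 0 => z _; exists 0; rewrite /= ?in_itv /= ?ler01 ?lexx //.
  by rewrite rmorph0 mul0r.
move=> z _; apply: connected_continuous_connected;
  first exact: segment_connected.
apply: continuous_subspaceT => t; apply/cvg_normcP => e e0.
have z1 : 0 < normc z + 1 by rewrite ltr_wpDl ?normc_ge0.
have : \forall x \near t, `|t - x| < e / (normc z + 1).
  have /cvgrPdist_lt H : id @ t --> t by exact: cvg_id.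
  by apply: H; rewrite divr_gt0.
apply: filterS => x; rewrite ltr_pdivlMr // -mulrBl -rmorphB normcZ.
by apply: le_lt_trans; rewrite ler_wpM2l // lerDl.
Qed.

Theorem theorem5 (R : realType) (theta gamma : nat -> R)
  (theta_range : forall n, 0 <= theta n < 2 * pi)
  (theta_inj : injective theta)
  (gamma_gt0 : forall n, 0 < gamma n)
  (gamma_summable : cvg (series gamma @ \oo))
  (theta0 : theta 0%N = 0)
  (theta_range1 : forall n, (1 <= n)%N -> 0 < theta n < 1)
  (theta_decr : forall n, (1 <= n)%N -> theta n.+1 < theta n)
  (theta_cvg0 : theta @ \oo --> 0)
  (gap : exists C : R, 0 < C /\
    \forall n \near \oo,
      `|theta n.-1 - theta n.+1| <= C * gamma n ^+ 2) :
  one_component_inner (atomic_singular theta gamma).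
Proof.
have theta_gt0 n : (1 <= n)%N -> 0 < theta n by move=> /theta_range1 /andP[].
split; first split.
- exact: bounded_analytic_atomic_singular.
- have theta_countable : countable (range theta).
    exact: sub_countable (card_image_le _ _) (countableP _).
  exists (range theta); split.
  + by apply: countable_measurable => // r; exact: measurable_set1.
  + exact: countable_lebesgue_measure0.
  move=> t /= nt; apply: contrapT => tn; apply: nt => t02.
  apply: radial_limit_atomic_singular => // [n|].
    apply/eqP => /cis_inj tE; apply: tn; exists n => //; exact/esym/tE.
  apply: (cvg_normc_le (r := fun n => `|theta n|)).
    apply: nearW => n; apply: le_trans (chord_le _ _) _.
    by rewrite theta0 sub0r normrN.
  by rewrite -(normr0 R); exact: cvg_norm.
have [C [C0 gapC]] := gap.
have [K K0 gapK] := gap_linear gamma_gt0 gamma_summable theta_decr C0 gapC.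
(* Half of the constant of [potential_ge_near_atom], to get a strict bound. *)
pose L := Num.min (gamma 0%N) K / 8.
have m0 : 0 < Num.min (gamma 0%N) K by rewrite lt_min gamma_gt0.
have L0 : 0 < L by rewrite divr_gt0.
exists (expR (- L)); split; first by rewrite expR_gt0 expR_lt1 oppr_lt0.
have levelE z : level_set (atomic_singular theta gamma) (expR (- L)) z <->
    normc z < 1 /\ L < potential theta gamma z.
  rewrite /level_set /= normc_normr ltcR; split=> [[/unit_discE z1]|[z1 Lz]].
    by rewrite normc_atomic_singular // ltr_expR ltrN2.
  by split; [exact/unit_discE|rewrite normc_atomic_singular // ltr_expR ltrN2].
apply: star_shaped_connected => z t /levelE[z1 Lz] /andP[t0 t1].
have tz1 : normc (t%:C * z) < 1.
  by rewrite normcZ ger0_norm // (le_lt_trans _ z1) // ler_piMl ?normc_ge0.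
apply/levelE; split=> //.
have [[m near_m]|far] := pselect (exists m,
    normc (t%:C * z - cis (theta m)) <= 1 - normc (t%:C * z) ^+ 2).
  have ctz := @potential_cvg _ theta _ gamma_gt0 gamma_summable _ tz1.
  have := potential_ge_near_atom gamma_gt0 theta0 theta_gt0 theta_decr
    theta_cvg0 K0 gapK tz1 ctz near_m.
  by apply: lt_le_trans; rewrite /L; lra.
apply: lt_le_trans Lz _; apply: lim_series_le; [exact: potential_cvg..|].
move=> n; apply: ler_wpM2l; first exact: ltW.
have t01 : 0 <= t <= 1 by rewrite t0.
have [//|near_n] := radial_alternative (normc_cis (theta n)) z1 t01.
by case: far; exists n.
Qed.
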